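(* Let $\Gamma=\{x^1,\ldots,x^M\}$ be a finite set of points in $X$ and let $X'$ be a full dimensional compact set containing $\Gamma$ on which the flow of $\dot x=f(x)$ can be rectified, i.e., there exists a diffeomorphism $\zeta:Y'\to X'$ through which $\dot x=f(x)$ is conjugate to $$\dot y=(0,\ldots,0,1)$$ with $Y'\subset\mathbb{R}^n$ convex. Assume that no two points in the set $\Gamma$ lie on the same trajectory of $\dot x=f(x)$. Then there exists an $(n-1)$-dimensional surface $\hat\Gamma\supset\Gamma$, closed in the standard topology of $\mathbb{R}^n$, such that $x\in\hat\Gamma$ implies $S_t(x)\notin\hat\Gamma$ for any $t>0$ satisfying $S_{t'}(x)\in X'$ for all $t'\in[0,t]$.
   Context: Let $X\subset\mathbb{R}^n$ and let $f$ be a Lipschitz continuous vector field on $X$. Consider the dynamical system $\dot x=f(x)$ with state $x\in X$. Its flow is denoted by $S_t(x)$, i.e. $\frac{d}{dt}S_t(x)=f(S_t(x))$, $S_0(x)=x$, and it is assumed to be well defined for all $x\in X$ and all $t\ge 0$. Two dynamical systems $\dot x=f_1(x)$ and $\dot y=f_2(y)$ are conjugate through a diffeomorphism $\zeta$ if the associated flows $S_{1,t}$ and $S_{2,t}$ satisfy $S_{1,t}(x)=\zeta(S_{2,t}(\zeta^{-1}(x)))$; for the vector fields this means $f_2(y)=\big(\frac{\partial\zeta}{\partial y}\big)^{-1}f_1(\zeta(y))$. *)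

(* Defs.v *)
(* The state space is 'rV[R]_n.+1, i.e. R^N with N = n.+1,
   with its sup norm (all norms being equivalent, the choice is immaterial for
   the Lipschitz, compactness and differentiability conditions below). *)
From HB Require Import structures.
From mathcomp Require Import all_boot all_order all_algebra.
From mathcomp Require Import all_classical all_reals all_analysis.
Set Implicit Arguments.
Unset Strict Implicit.
Unset Printing Implicit Defensive.
Import Order.TTheory GRing.Theory Num.Theory.
Import numFieldNormedType.Exports.
Local Open Scope classical_set_scope.
Local Open Scope ring_scope.

(* S t x is meaningful only for x in X and t >= 0, so the time derivative is
   taken within [0, +oo[; in particular it is one-sided at t = 0. *)
Definition is_flow (R : realType) (N : nat) (X : set 'rV[R]_N)
    (f : 'rV[R]_N -> 'rV[R]_N) (S : R -> 'rV[R]_N -> 'rV[R]_N) : Prop :=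
  forall x, X x ->
    S 0 x = x /\
    forall t, 0 <= t ->
      X (S t x) /\
      ((s - t)^-1 *: (S s x - S t x))
        @[s --> within [set s | 0 <= s] t^'] --> f (S t x).

Definition same_trajectory (R : realType) (N : nat) (X : set 'rV[R]_N)
    (S : R -> 'rV[R]_N -> 'rV[R]_N) (p q : 'rV[R]_N) : Prop :=
  exists z, X z /\ exists s t, [/\ 0 <= s, 0 <= t, S s z = p & S t z = q].

Definition C1_on (R : realType) (m N : nat) (U : set 'rV[R]_m)
    (g : 'rV[R]_m -> 'rV[R]_N) : Prop :=
  open U /\
  forall u, U u -> differentiable g u /\ {for u, continuous (jacobian g)}.

(* As B and A need not be open, smoothness on them means being C^1 on an open
   neighbourhood; the values of zeta off B and of zetai off A are irrelevant. *)
Definition diffeomorphism (R : realType) (N : nat) (B A : set 'rV[R]_N)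
    (zeta zetai : 'rV[R]_N -> 'rV[R]_N) : Prop :=
  [/\ forall y, B y -> A (zeta y) /\ zetai (zeta y) = y,
      forall x, A x -> B (zetai x) /\ zeta (zetai x) = x,
      exists U, B `<=` U /\ C1_on U zeta
    & exists V, A `<=` V /\ C1_on V zetai].

(* Conjugacy on A of the systems (f1, S1) and (f2, S2) through zeta : B -> A,
   in terms of the flows and of the vector fields.  Since A and B need not be
   invariant, the flow identity is required as long as both orbits have stayed
   in A and in B respectively.  Vectors are rows, so Jacobians act on the
   right: 'd zeta y v = v *m 'J zeta y. *)
Definition conjugate_on (R : realType) (N : nat) (B A : set 'rV[R]_N)
    (zeta zetai f1 : 'rV[R]_N -> 'rV[R]_N) (S1 : R -> 'rV[R]_N -> 'rV[R]_N)
    (f2 : 'rV[R]_N -> 'rV[R]_N) (S2 : R -> 'rV[R]_N -> 'rV[R]_N) : Prop :=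
  (forall x t, A x -> 0 <= t ->
     (forall s, 0 <= s <= t -> A (S1 s x)) ->
     (forall s, 0 <= s <= t -> B (S2 s (zetai x))) ->
     S1 t x = zeta (S2 t (zetai x))) /\
  (forall y, B y -> f2 y = f1 (zeta y) *m invmx (jacobian zeta y)).

Definition e_last (R : realType) (n : nat) : 'rV[R]_n.+1 := delta_mx 0 ord_max.

Definition rectifiable_on (R : realType) (n : nat) (A : set 'rV[R]_n.+1)
    (f : 'rV[R]_n.+1 -> 'rV[R]_n.+1)
    (S : R -> 'rV[R]_n.+1 -> 'rV[R]_n.+1) : Prop :=
  exists (B : set 'rV[R]_n.+1) (zeta zetai : 'rV[R]_n.+1 -> 'rV[R]_n.+1)
         (T : R -> 'rV[R]_n.+1 -> 'rV[R]_n.+1),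
    [/\ convex_set B,
        diffeomorphism B A zeta zetai,
        is_flow setT (fun=> e_last R n) T
      & conjugate_on B A zeta zetai f S (fun=> e_last R n) T].

Definition orthant (R : realType) (k : nat) : set 'rV[R]_k :=
  [set u | forall i, 0 <= u 0 i].

(* G is an embedded k-dimensional C^1 surface in R^N, possibly with boundary
   and corners: around each of its points, G is the image of a relatively open
   part O `&` orthant of [0, +oo[^k under a C^1 map psi with injective
   differential which is a homeomorphism onto its image (with inverse chi).
   Boundary and corners have to be allowed: a hypersurface contained in X may
   have to pass through a corner of X. *)
Definition surface (R : realType) (k N : nat) (G : set 'rV[R]_N) : Prop :=
  forall p, G p ->
    exists (O : set 'rV[R]_k) (W : set 'rV[R]_N)
           (psi : 'rV[R]_k -> 'rV[R]_N) (chi : 'rV[R]_N -> 'rV[R]_k),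
      [/\ open W /\ W p,
          C1_on O psi,
          psi @` (O `&` @orthant R k) = W `&` G,
          forall u, O u -> orthant u -> injective ('d psi u)
        & (forall u, O u -> orthant u -> chi (psi u) = u) /\
          {within W `&` G, continuous chi}].

(* Main.v *)
Require Import Defs.
From HB Require Import structures.
From mathcomp Require Import all_boot all_order all_algebra.
From mathcomp Require Import all_classical all_reals all_analysis.
From mathcomp Require Import ring.
Import Order.TTheory GRing.Theory Num.Theory.
Import numFieldNormedType.Exports.
Local Open Scope classical_set_scope.
Local Open Scope ring_scope.
Set Implicit Arguments.
Unset Strict Implicit.
Unset Printing Implicit Defensive.

(** In the rectifying coordinates y = zetai x the flow, as long as it stays in
    X', is the translation y + t * e_last, so it preserves the projection of y
    that forgets the last coordinate, and a piece of surface on which this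
    projection is injective meets no orbit segment in X' twice.  It
    therefore suffices to put through each point of Gamma a small flat piece
    transversal to e_last, and to keep the projections of different pieces
    apart.

    The pieces must stay inside the convex set B, even when a point of Gamma
    lies on its boundary, for instance at the tip of a corner.  Since the image
    of B is full dimensional, B lies in no hyperplane
    ([diffeo_not_in_hyperplane]); hence from every y of B there are n edges
    towards points of B whose projections form a basis
    ([unitmx_of_spanning_rows]), and by convexity the parallelepiped spanned by
    short multiples of these edges is contained in B ([transversal_box]).  Its
    image under zeta is a compact surface with corners ([patch_surface]), and a
    finite disjoint union of such surfaces is again one ([surface_bigcup]).

    Different points of Gamma have different projections
    ([same_trajectory_of_drop_last]): otherwise the vertical segment between
    them lies in B, its image under zeta solves the differential equation, and
    by uniqueness of solutions ([ode_unique]) it is an orbit segment of S that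
    joins them.  In the other direction, an orbit segment that remains in X' is
    carried by zetai to a solution of the constant field e_last, that is, to a
    vertical segment ([flow_rectified]).  Both facts transport a vector field
    through zeta, which requires the Jacobian of zeta to be invertible at every
    point of B, boundary points included ([diffeo_jacobianV]). *)

(** * Calculus of row-vector valued maps *)

Section MatrixCalculus.
Variable R : realType.

Lemma cvg_mx_coord (T : Type) (F : set_system T) (m n : nat)
    (g : T -> 'M[R]_(m, n)) (l : 'M[R]_(m, n)) :
  Filter F -> (forall i j, (g x i j @[x --> F]) --> l i j) -> g @ F --> l.
Proof.
move=> FF gl; apply/cvgrPdist_le => e e0; near=> x.
rewrite /Num.Def.normr/= mx_normrE (bigmax_le _ (ltW e0))//= => ij _.
rewrite !mxE; move: ij; near: x; apply: filter_forall => -[i j] /=.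
by move/cvgrPdist_le: (gl i j); exact.
Unshelve. all: by end_near. Qed.

Lemma cvg_coord (T : Type) (F : set_system T) (m n : nat)
    (g : T -> 'M[R]_(m, n)) (l : 'M[R]_(m, n)) i j :
  Filter F -> g @ F --> l -> (g x i j @[x --> F]) --> l i j.
Proof.
by move=> FF gl; exact: (continuous_cvg _ (@coord_continuous _ _ _ i j l) gl).
Qed.

Lemma cvg_mulmx (T : Type) (F : set_system T) (m n p : nat)
    (g : T -> 'M[R]_(m, n)) (h : T -> 'M[R]_(n, p)) (a : 'M[R]_(m, n)) b :
  Filter F -> g @ F --> a -> h @ F --> b -> g x *m h x @[x --> F] --> a *m b.
Proof.
move=> FF ga hb; apply: cvg_mx_coord => i j; rewrite mxE.
under eq_fun do rewrite mxE.
apply: cvg_big => [|k _]; first exact: add_continuous.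
by apply: cvgM; exact: cvg_coord.
Qed.

Lemma mulmxr_continuous (k m n : nat) (M : 'M[R]_(m, n)) :
  continuous (mulmxr M : 'M[R]_(k, m) -> 'M[R]_(k, n)).
Proof.
move=> u; rewrite /continuous_at /mulmxr /=.
have Mc : (fun=> M) @ nbhs u --> M by apply: cvg_cst.
exact: (@cvg_mulmx _ (nbhs u) _ _ _ id _ u _ _ (@cvg_id _ _) Mc).
Qed.

Lemma affine_is_diff (m n : nat) (b : 'rV[R]_n) (M : 'M[R]_(m, n)) u :
  is_diff u (fun v => b + v *m M) (mulmxr M).
Proof.
have -> : (fun v => b + v *m M) = cst b + (mulmxr M : 'rV_m -> 'rV_n) by [].
have dM : is_diff u (mulmxr M : 'rV_m -> 'rV_n) (mulmxr M).
  apply: DiffDef; first exact: linear_differentiable (@mulmxr_continuous _ _ _ M).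
  exact: diff_lin (@mulmxr_continuous _ _ _ M).
by apply: is_diff_eq; rewrite add0r.
Qed.

Lemma affine_continuous (m n : nat) (b : 'rV[R]_n) (M : 'M[R]_(m, n)) :
  continuous (fun v : 'rV[R]_m => b + v *m M).
Proof.
move=> u; apply: differentiable_continuous.
by case: (affine_is_diff b M u).
Qed.

Lemma jacobian_affine (m n : nat) (b : 'rV[R]_n) (M : 'M[R]_(m, n)) u :
  'J (fun v => b + v *m M) u = M.
Proof.
have dM := affine_is_diff b M u.
apply/row_matrixP => i; rewrite !rowE mul_rV_lin1/=.
by rewrite (@diff_val _ _ _ _ _ _ _ dM).
Qed.

Lemma diffEjacobian (m n : nat) (g : 'rV[R]_m -> 'rV[R]_n) u v :
  'd g u v = v *m 'J g u.
Proof. by rewrite mul_rV_lin1. Qed.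

Lemma jacobian_comp (m n p : nat) (g : 'rV[R]_m -> 'rV[R]_n)
    (h : 'rV[R]_n -> 'rV[R]_p) u :
  differentiable g u -> differentiable h (g u) ->
  'J (h \o g) u = 'J g u *m 'J h (g u).
Proof.
move=> dg dh; apply/row_matrixP => i; rewrite !rowE mulmxA -!diffEjacobian.
by rewrite diff_comp.
Qed.

Lemma jacobian_near_id (m : nat) (g : 'rV[R]_m -> 'rV[R]_m) u :
  differentiable g u -> (\forall x \near u, g x = x) -> 'J g u = 1%:M.
Proof.
move=> dg gid; apply/row_matrixP => i; rewrite !rowE -deriveEjacobian//.
by rewrite (near_eq_derive _ gid) derive_id mulmx1.
Qed.

Lemma near_eq_continuous (T U : topologicalType) (g h : T -> U) x :
  (\forall y \near x, g y = h y) -> {for x, continuous h} ->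
  {for x, continuous g}.
Proof.
move=> gh hx; rewrite /prop_for /continuous_at (nbhs_singleton gh).
by apply: cvg_trans hx; apply: near_eq_cvg; apply: filterS gh.
Qed.

Lemma C1_affine (m p : nat) (b : 'rV[R]_p) (M : 'M[R]_(m, p)) v :
  differentiable (fun v => b + v *m M) v /\
  {for v, continuous (jacobian (fun v => b + v *m M))}.
Proof.
split; first by case: (affine_is_diff b M v).
apply: (@near_eq_continuous _ _ _ (cst M)).
  by near=> w; exact: jacobian_affine.
exact: cst_continuous.
Unshelve. all: by end_near. Qed.

Lemma C1_on_comp (m p q : nat) (O : set 'rV[R]_m) (U : set 'rV[R]_p)
    (h : 'rV[R]_m -> 'rV[R]_p) (g : 'rV[R]_p -> 'rV[R]_q) :
  C1_on O h -> C1_on U g -> O `<=` h @^-1` U -> C1_on O (g \o h).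
Proof.
move=> [oO C1h] [oU C1g] OU; split=> // v Ov.
have [dh cJh] := C1h v Ov; have [dg cJg] := C1g _ (OU v Ov).
split; first exact: differentiable_comp.
apply: (@near_eq_continuous _ _ _ (fun w => 'J h w *m 'J g (h w))).
  near=> w; have Ow : O w by near: w; exact: open_nbhs_nbhs.
  by apply: jacobian_comp; [case: (C1h w Ow)|case: (C1g _ (OU w Ow))].
apply: (cvg_mulmx _ cJh (continuous_comp _ cJg)).
exact: differentiable_continuous.
Unshelve. all: by end_near. Qed.

Lemma coord_norm_le (m n : nat) (w : 'M[R]_(m, n)) i j : `|w i j| <= `|w|.
Proof.
by rewrite [leRHS]/Num.Def.normr/= mx_normrE; exact: (le_bigmax _ _ (i, j)).
Qed.

(** The norm on row vectors is the sup norm; a sum of squares dominates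
    it and, unlike it, is differentiable. *)
Lemma norm_sqr_le_sum (m : nat) (w : 'rV[R]_m) : `|w| ^+ 2 <= \sum_i w 0 i ^+ 2.
Proof.
have s0 : 0 <= \sum_i w 0 i ^+ 2 by apply: sumr_ge0 => i _; exact: sqr_ge0.
rewrite -(sqr_sqrtr s0) lerXn2r ?nnegrE ?sqrtr_ge0//.
rewrite /Num.Def.normr/= mx_normrE; apply: bigmax_le; first exact: sqrtr_ge0.
move=> [i j] _ /=; rewrite ord1 -sqrtr_sqr ler_wsqrtr// (bigD1 j)//= lerDl.
by apply: sumr_ge0 => k _; exact: sqr_ge0.
Qed.

Lemma is_derive_coord (m : nat) (u : R -> 'rV[R]_m) (t : R) du i :
  is_derive t 1 u du -> is_derive t 1 (fun s => u s 0 i) (du 0 i).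
Proof.
move=> [du1 <-]; apply: DeriveDef; first exact: (derivable_mxP _ _ _).1.
by rewrite derive_mx// mxE.
Qed.

End MatrixCalculus.

(** * Solutions of differential equations *)

Section Ode.
Variable R : realType.

(** At the endpoints only continuity is asked for: a flow is differentiable at
    time 0 from one side only, and continuity there is all that the mean value
    theorem needs. *)
Definition solves (m : nat) (f : 'rV[R]_m -> 'rV[R]_m) (b : R)
    (u : R -> 'rV[R]_m) : Prop :=
  {within `[0, b], continuous u} /\
  forall t, 0 < t < b -> is_derive t 1 u (f (u t)).

(** Gronwall's argument.  For two solutions u and v in X, let E be the sum of
    the squares of the coordinates of u - v.  A k-Lipschitz field on R^m gives
    E' <= 2 k m E, so E multiplied by the exponential of - 2 k m t decreases
    from 0, and E vanishes. *)
Lemma ode_unique (m : nat) (X : set 'rV[R]_m) (f : 'rV[R]_m -> 'rV[R]_m)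
    (b : R) (u v : R -> 'rV[R]_m) :
  [lipschitz f x | x in X] -> 0 < b -> solves f b u -> solves f b v ->
  (forall t, 0 <= t <= b -> X (u t) /\ X (v t)) -> u 0 = v 0 -> u b = v b.
Proof.
move=> /pinfty_ex_gt0[k k0 fk] b0 [uc du] [vc dv] Xuv uv0.
have {}fk x y : X x -> X y -> `|f x - f y| <= k * `|x - y|.
  by move=> Xx Xy; exact: (fk (x, y)).
pose w t := u t - v t.
have wc : {within `[0, b], continuous w}.
  by move=> x; apply: (@cvgB _ _ _ (nbhs x)); [exact: uc|exact: vc].
pose E t : R := \sum_i w t 0 i ^+ 2.
have E0 t : 0 <= E t by apply: sumr_ge0 => i _; exact: sqr_ge0.
have Ec : {within `[0, b], continuous E}.
  move=> x; apply: cvg_big => [|i _]; first exact: add_continuous.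
  by rewrite expr2; apply: cvgM; apply: cvg_coord; exact: wc.
pose c := (k * m%:R) *+ 2.
pose g t := E t * expR (- (c * t)).
have gc : {within `[0, b], continuous g}.
  move=> x; apply: (@cvgM _ _ (nbhs x)); first exact: Ec.
  apply: (@continuous_subspaceT _ _ _ (fun t => expR (- (c * t)))) => t.
  apply: continuous_comp; last exact: continuous_expR.
  by apply: continuousN; apply: mulrl_continuous.
have dg t : t \in `]0, b[ -> is_derive t 1 g
    ((\sum_i (w t 0 i * (f (u t) - f (v t)) 0 i) *+ 2 - c * E t)
     * expR (- (c * t))).
  rewrite in_itv/= => tb.
  have dw : is_derive t 1 w (f (u t) - f (v t)).
    by apply: is_deriveB; [exact: du|exact: dv].
  have dE : is_derive t 1 E (\sum_i (w t 0 i * (f (u t) - f (v t)) 0 i) *+ 2).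
    have -> : E = \sum_i (fun s => w s 0 i) ^+ 2.
      by apply/funext => s; rewrite fct_sumE.
    apply: is_derive_sum => i.
    have dwi := is_derive_coord i dw.
    apply: is_derive_eq.
    by rewrite /GRing.scale/=; ring.
  have de : is_derive t 1 (fun s => expR (- (c * s))) (- c * expR (- (c * t))).
    have dl : is_derive t 1 (fun s : R => - (c * s)) (- c).
      have -> : (fun s : R => - (c * s)) = - (c *: id) by [].
      by apply: is_derive_eq; rewrite /GRing.scale/= mulr1.
    rewrite mulrC; exact: (is_derive1_comp (f := expR)).
  have -> : g = E * (fun s => expR (- (c * s))) by [].
  apply: is_derive_eq; rewrite /GRing.scale/=; ring.
have dgle t : t \in `]0, b[ -> g^`()%classic t <= 0.
  move=> tb; have [_] := dg _ tb; rewrite derive1E => ->.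
  rewrite mulr_le0_ge0 ?expR_ge0// subr_le0.
  move: tb; rewrite in_itv/= => /andP[t0 tb].
  have /Xuv[Xu Xv] : 0 <= t <= b by rewrite !ltW.
  apply: (@le_trans _ _ (\sum_(i < m) (k * E t) *+ 2)).
    apply: ler_sum => i _; rewrite lerMn2r/=.
    apply: (le_trans (ler_norm _)); rewrite normrM.
    apply: (@le_trans _ _ (`|w t| * (k * `|w t|))).
      by apply: ler_pM => //; [exact: coord_norm_le|
         exact: le_trans (coord_norm_le _ _ _) (fk _ _ Xu Xv)].
    rewrite mulrCA -expr2; apply: (ler_wpM2l (ltW k0)); exact: norm_sqr_le_sum.
  rewrite sumr_const card_ord /c -(mulr_natr (k * E t *+ 2)).
  by rewrite !mulrnAl mulrAC.
have gle : g b <= g 0.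
  have dgd t : t \in `]0, b[ -> derivable g t 1 by move=> /dg[].
  by apply: (ler0_derive1_le_cc dgd dgle gc); rewrite ?in_itv/= ?lexx ?ltW.
have gb : E b = 0.
  have E00 : E 0 = 0.
    by rewrite /E big1// => i _; rewrite /w uv0 subrr mxE expr0n.
  move: gle; rewrite /g E00 mul0r pmulr_lle0 ?expR_gt0// => Eb.
  by apply/eqP; rewrite eq_le Eb E0.
have wb : `|u b - v b| ^+ 2 <= 0 by rewrite -gb; exact: norm_sqr_le_sum.
by apply/eqP; rewrite -subr_eq0 -normr_eq0 -sqrf_eq0 eq_le wb sqr_ge0.
Qed.

Lemma flow_solves (m : nat) (X : set 'rV[R]_m) (f : 'rV[R]_m -> 'rV[R]_m)
    (S : R -> 'rV[R]_m -> 'rV[R]_m) x (b : R) :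
  is_flow X f S -> X x -> 0 < b -> solves f b (S ^~ x).
Proof.
move=> + Xx b0 => /(_ x Xx)[S0 Sx].
have dS (t : R) : 0 < t -> is_derive t (1 : R) (S ^~ x) (f (S t x)).
  move=> t0; have [_] := Sx t (ltW t0).
  (* for t > 0 the constraint 0 <= s holds near t, so the limit within it is
     the two-sided derivative *)
  have sh : (h *: 1 + t) @[h --> 0^'] --> within [set s : R | 0 <= s] t^'.
    move=> P /nbhs_ballP[e /= e0 eP].
    suff : \forall h \near 0^', P (h *: 1 + t) by [].
    near=> h; have h0 : h != 0 by near: h; exact: nbhs_dnbhs_neq.
    have ht : `|h| < t by near: h; exact: dnbhs0_lt.
    apply: eP; rewrite /ball/= /GRing.scale/= mulr1.
    + rewrite opprD addrCA subrr addr0 normrN.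
      by near: h; exact: dnbhs0_lt.
    + by rewrite -subr_eq0 addrK.
    + by move: ht; rewrite ltr_norml => /andP[ht _]; rewrite -lerBlDr sub0r ltW.
  move=> /(cvg_comp _ _ sh) ct.
  suff lim : h^-1 *: (S (h *: 1 + t) x - S t x) @[h --> 0^'] --> f (S t x).
    by apply: DeriveDef; [apply: cvgP lim|exact: cvg_lim].
  move: ct; apply: cvg_trans; apply: near_eq_cvg; near=> h.
  by rewrite /= addrK /GRing.scale/= mulr1.
have cS (t : R) : 0 < t -> {for t, continuous (S ^~ x)}.
  move=> /dS[dSt _]; apply: differentiable_continuous.
  exact/derivable1_diffP.
split => [|t /andP[t0 _]]; last exact: dS.
apply/continuous_within_itvP => //; split.
- by move=> t; rewrite in_itv/= => /andP[t0 _]; exact: cS.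
- (* S s x - x is s times a difference quotient that converges *)
  have [_ q] := Sx 0 (lexx 0).
  have rw : 0^'+ `=>` within [set s : R | 0 <= s] 0^'.
    move=> P HP.
    by apply: (@filterS _ (nbhs (0 : R)) _ _ _ _ HP) => s /= sP s0;
      exact: (sP (lt0r_neq0 s0) (ltW s0)).
  have {}q := cvg_trans (cvg_app _ rw) q.
  have id0 : (s - 0) @[s --> (0:R)^'+] --> (0 : R).
    under eq_fun do rewrite subr0.
    by apply: cvg_at_right_filter; exact: cvg_id.
  have c0 : (fun=> S 0 x) @ (0 : R)^'+ --> S 0 x by apply: cvg_cst.
  have := cvgD (cvgZ id0 q) c0.
  rewrite scale0r add0r => lim0; apply: (cvg_trans _ (lim0 _ _)).
  apply: near_eq_cvg; near=> s.
  have s0 : 0 < s by near: s; exact: nbhs_right_gt.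
  by rewrite fctE/= subr0 scalerA divff ?lt0r_neq0// scale1r subrK.
- by apply: cvg_at_left_filter; exact: cS.
Unshelve. all: by end_near. Qed.

(** Chain rule: h carries solutions of f to solutions of its push-forward. *)
Lemma solves_comp (m p : nat) (f : 'rV[R]_m -> 'rV[R]_m)
    (g : 'rV[R]_p -> 'rV[R]_p) (h : 'rV[R]_m -> 'rV[R]_p) (b : R)
    (u : R -> 'rV[R]_m) :
  solves f b u -> (forall t, 0 <= t <= b -> differentiable h (u t)) ->
  (forall t, 0 < t < b -> g (h (u t)) = f (u t) *m 'J h (u t)) ->
  solves g b (h \o u).
Proof.
move=> [uc du] dh hg; split.
  apply/subspace_continuousP => t; rewrite /= in_itv/= => tb.
  move/subspace_continuousP: uc => /(_ t); rewrite /= in_itv/= => /(_ tb) uc.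
  apply: (cvg_comp _ _ uc).
  exact: differentiable_continuous (dh t tb).
move=> t tb; have [ut utE] := du t tb.
have dht : differentiable h (u t).
  by apply: dh; move: tb => /andP[t0 tb]; rewrite !ltW.
have dut : differentiable u t by exact/derivable1_diffP.
apply: DeriveDef.
  by apply: diff_derivable; exact: differentiable_comp.
rewrite deriveE; last exact: differentiable_comp.
by rewrite diff_comp//= diffEjacobian -(deriveE _ dut) utE hg.
Qed.

Lemma line_solves (m : nat) (y e : 'rV[R]_m) (b : R) :
  solves (fun=> e) b (fun t => y + t *: e).
Proof.
have d t : is_derive t (1 : R) (fun t => y + t *: e) e.
  have -> : (fun t => y + t *: e) = cst y + (fun t : R => t *: e) by [].
  have sd := is_diff_scalel t e.
  rewrite -[e in is_derive _ _ _ e]add0r; apply: is_deriveD; apply: DeriveDef.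
    exact: diff_derivable.
  by rewrite deriveE// diff_val scale1r.
split=> [|t _]; last exact: d.
apply: continuous_subspaceT => t.
by apply: differentiable_continuous; apply/derivable1_diffP; case: (d t).
Qed.

End Ode.

(** * Linear algebra and convexity *)

Section Spanning.
Variable R : realType.

Lemma mulmx1_eq0 (m k : nat) (P Q : 'M[R]_m) (c : 'M[R]_(m, k)) :
  P *m Q = 1%:M -> P *m c = 0 -> c = 0.
Proof.
by move=> /mulmx1C QP Pc; rewrite -[c]mul1mx -QP -mulmxA Pc mulmx0.
Qed.

Lemma mulmx_eq_trans (p q r t : nat) (P : 'M[R]_(q, r)) (Q : 'M[R]_(r, t)) T
    (w1 w2 : 'M[R]_(p, q)) :
  P *m Q = T -> w1 *m P = w2 *m P -> w1 *m T = w2 *m T.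
Proof. by move=> <- wP; rewrite !mulmxA wP. Qed.

Lemma mulmx_invmxP (m k : nat) (P Q : 'M[R]_m) (v w : 'M[R]_(k, m)) :
  P *m Q = 1%:M -> v = w *m invmx P -> w = v *m P /\ v = w *m Q.
Proof.
move=> PQ ->; have [Pu _] := mulmx1_unit PQ.
by split; [rewrite mulmxKV|rewrite -[Q](mulKmx Pu) PQ mulmx1].
Qed.

Lemma convex_segment (m : nat) (B : set 'rV[R]_m) x y t :
  convex_set B -> B x -> B y -> 0 <= t <= 1 -> B (x + t *: (y - x)).
Proof.
move=> cB Bx By /andP[t0 t1]; have := cB y x (Itv01 t0 t1).
rewrite !inE => /(_ By Bx).
have -> : x + t *: (y - x) = t *: y + (1 - t) *: x; last by [].
by rewrite scalerBr scalerBl scale1r addrC addrAC addrA.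
Qed.

(** The weights sum to less than 1, not merely to at most 1, so that the
    induction on the number of edges can divide by 1 minus the first weight. *)
Lemma convex_corner (m k : nat) (B : set 'rV[R]_m) y (W : 'M[R]_(k, m))
    (u : 'rV[R]_k) :
  convex_set B -> B y -> (forall i, B (y + row i W)) ->
  (forall i, 0 <= u 0 i) -> \sum_i u 0 i < 1 -> B (y + u *m W).
Proof.
move=> cB By; elim: k W u => [|k IH] W u BW u0 u1.
  by rewrite thinmx0 mul0mx addr0.
move: u1; rewrite big_ord_recl; set c := u 0 ord0 => u1.
have rest0 : 0 <= \sum_(i < k) u 0 (lift ord0 i) by exact: sumr_ge0.
have c1 : 0 < 1 - c by rewrite subr_gt0 (le_lt_trans _ u1)// lerDl.
(* the point is a combination, with weight c, of the end of the first edge and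
   of the point z obtained by renormalizing the other weights *)
pose u' : 'rV_k := (1 - c)^-1 *: col' ord0 u.
have Bz : B (y + u' *m row' ord0 W).
  apply: IH => [i|i|].
  - have := BW (lift ord0 i); congr (B (_ + _)).
    by apply/rowP => j; rewrite !mxE.
  - by rewrite !mxE mulr_ge0// invr_ge0 ltW.
  - under eq_bigr do rewrite !mxE.
    by rewrite -mulr_sumr mulrC ltr_pdivrMr// mul1r ltrBrDl.
have c01 : 0 <= c <= 1 by rewrite u0 -subr_ge0 ltW.
have := convex_segment cB Bz (BW ord0) c01; congr (B _).
rewrite [u *m W]mulmx_sum_row big_ord_recl -/c.
have -> : \sum_(i < k) u 0 (lift ord0 i) *: row (lift ord0 i) W =
    (1 - c) *: (u' *m row' ord0 W).
  rewrite -scalemxAl scalerA divff ?gt_eqF// scale1r mulmx_sum_row.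
  apply: eq_bigr => i _; rewrite !mxE; congr (_ *: _).
  by apply/rowP => j; rewrite !mxE.
set z := u' *m _; set w := row ord0 W.
rewrite opprD addrA [y + w]addrC addrK scalerBr scalerBl scale1r.
by rewrite -!addrA; congr (_ + _); rewrite addrCA.
Qed.

(** A set of vectors whose images under D are annihilated by no nonzero
    functional contains n vectors with linearly independent images; they are
    picked one at a time. *)
Lemma unitmx_of_spanning_rows (m n : nat) (P : set 'rV[R]_m) (D : 'M[R]_(m, n)) :
  (forall c : 'cV[R]_n, (forall w, P w -> w *m D *m c = 0) -> c = 0) ->
  exists2 W : 'M[R]_(n, m), (forall i, P (row i W)) & W *m D \in unitmx.
Proof.
move=> spanP.
suff H k : (k <= n)%N ->
    exists2 W : 'M[R]_(k, m), (forall i, P (row i W)) & row_free (W *m D).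
  by have [W PW] := H n (leqnn n); rewrite row_free_unit; exists W.
elim: k => [_|k IH kn].
  by exists 0 => [[]//|]; rewrite /row_free mxrank.unlock/= //.
have [W PW Wfree] := IH (ltnW kn).
(* k rows with k < n have a common annihilator c, and some w of P avoids it *)
have [j cj0] : exists j, col j (cokermx (W *m D)) != 0.
  apply/existsP; apply: contraT; rewrite negb_exists => /forallP c0.
  have : cokermx (W *m D) == 0.
    apply/eqP/matrixP => a b; have /negPn/eqP := c0 b.
    by move/matrixP => /(_ a 0); rewrite !mxE.
  rewrite -mxrank_eq0 mxrank_coker subn_eq0 leqNgt.
  by rewrite (eqP Wfree) kn.
set c := col j _ in cj0.
have Wc : W *m D *m c = 0.
  by rewrite /c colE mulmxA mulmx_coker mul0mx.
have [w Pw wc] : exists2 w, P w & w *m D *m c <> 0.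
  apply: contrapT => H; move/eqP: cj0; apply; apply: spanP => w Pw.
  by apply: contrapT => wc; apply: H; exists w.
(* w *m D is not in the row space of W *m D, as c separates them *)
exists (col_mx w W : 'M[R]_(1 + k, m)).
  move=> /= i; have [a ->|a ->] := @split_ordP 1 k i.
    suff: P (row (lshift k a) (col_mx w W)) by [].
    by rewrite rowKu [row a w]row_id.
  suff: P (row (rshift 1 a) (col_mx w W)) by [].
  by rewrite rowKd.
suff: row_free (col_mx w W *m D) by [].
rewrite mul_col_mx; apply: inj_row_free => v.
rewrite -(hsubmxK v); set a := lsubmx v; set b := rsubmx v.
rewrite mul_row_col => ab0.
have a0 : a = 0.
  have := congr1 (mulmx^~ c) ab0.
  rewrite mulmxDl -!(mulmxA a) -(mulmxA b) Wc mulmx0 addr0 mul0mx.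
  rewrite [a]mx11_scalar mul_scalar_mx => /eqP; rewrite scaler_eq0.
  by move=> /orP[/eqP->|/eqP//]; rewrite raddf0.
move: ab0; rewrite a0 mul0mx add0r => b0.
have -> : b = 0 by apply: (row_free_inj Wfree); rewrite mul0mx.
by rewrite row_mx0.
Qed.

(** The pairs with equal images get the value 1, so that the minimum ranges over
    positive numbers only. *)
Lemma finite_separated (T : choiceType) (P : set T) (V : normedModType R)
    (g : T -> V) :
  finite_set P -> (forall p q, P p -> P q -> p <> q -> g p <> g q) ->
  exists2 e : R, 0 < e & forall p q, P p -> P q -> p <> q -> e <= `|g p - g q|.
Proof.
move=> /finite_seqP[s ->] gs.
pose F (x : T * T) := if g x.1 == g x.2 then 1 else `|g x.1 - g x.2|.
have F0 x : 0 < F x.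
  by rewrite /F; case: eqP => // /eqP; rewrite -subr_eq0 normr_gt0.
exists (\big[Num.min/1]_(x <- allpairs pair s s) F x).
  by elim/big_ind: _ => // a b a0 b0; rewrite lt_min a0.
move=> p q ps qs pq.
have pqs : (p, q) \in allpairs pair s s by apply/allpairsP; exists (p, q).
apply: (@le_trans _ _ (F (p, q))); first exact: ge_bigmin_seq.
by rewrite /F/=; case: eqP (gs p q ps qs pq).
Qed.

End Spanning.

(** * The Jacobian of a diffeomorphism onto a set with interior *)

Section Diffeo.

Variables (R : realType) (m : nat) (A B : set 'rV[R]_m)
  (zeta zetai : 'rV[R]_m -> 'rV[R]_m).
Hypothesis dzeta : diffeomorphism B A zeta zetai.

Let zetaK y : B y -> A (zeta y) /\ zetai (zeta y) = y.
Proof. by case: dzeta => + _ _ _; exact. Qed.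

Let zetaiK x : A x -> B (zetai x) /\ zeta (zetai x) = x.
Proof. by case: dzeta => _ + _ _; exact. Qed.

Lemma diffeo_diff y : B y -> differentiable zeta y.
Proof. by case: dzeta => _ _ [U [BU [_ dU]]] _ /BU /dU []. Qed.

Lemma diffeo_diff_inv x : A x -> differentiable zetai x.
Proof. by case: dzeta => _ _ _ [U [BU [_ dU]]] /BU /dU []. Qed.

(** If a linear function were constant on B, its composite with zetai would be
    constant near an interior point x0 of A; but the derivative of zetai at x0 is
    invertible, zeta being a two-sided inverse on a neighbourhood of x0. *)
Lemma diffeo_not_in_hyperplane : interior A !=set0 ->
  forall k y (c : 'M[R]_(m, k)), (forall z, B z -> (z - y) *m c = 0) -> c = 0.
Proof.
move=> [x0 Ax0] k y c Bc.
have Ax : A x0 := nbhs_singleton Ax0.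
have [Bz zx] := zetaiK Ax.
have dz := diffeo_diff Bz; have dzi := diffeo_diff_inv Ax.
have JJ : 'J zetai x0 *m 'J zeta (zetai x0) = 1%:M.
  rewrite -jacobian_comp//; apply: jacobian_near_id.
    exact: differentiable_comp.
  by near=> x; have /zetaiK[] : A x by near: x.
have dc u : is_diff u (fun v : 'rV[R]_m => - (y *m c) + v *m c) (mulmxr c).
  exact: affine_is_diff.
have Jc0 : 'J zetai x0 *m c = 0.
  rewrite -[c in LHS](jacobian_affine (- (y *m c)) c (zetai x0)).
  rewrite -jacobian_comp//.
  apply/row_matrixP => i; rewrite !rowE mulmx0 -deriveEjacobian; last first.
    exact: differentiable_comp.
  have -> := @near_eq_derive _ _ _ _ (cst 0) x0 (delta_mx 0 i).
    exact: derive_cst.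
  near=> x; rewrite /= addrC -mulmxBl; apply: Bc.
  by have /zetaiK[] : A x by near: x.
exact: (mulmx1_eq0 JJ Jc0).
Unshelve. all: by end_near. Qed.

(** At a boundary point y of B the identity zetai (zeta y) = y may
    fail on every neighbourhood of y.  By convexity it still holds along the
    segments from y to the points z of B, so the composite Jacobian fixes all
    the vectors z - y, and these span the space. *)
Lemma diffeo_jacobianV : convex_set B -> interior A !=set0 ->
  forall y, B y -> 'J zeta y *m 'J zetai (zeta y) = 1%:M.
Proof.
move=> cB A0 y By; apply/eqP; rewrite -subr_eq0; apply/eqP.
apply: (diffeo_not_in_hyperplane A0 (y := y)) => z Bz.
have [Az _] := zetaK By.
have dz := diffeo_diff By; have dzi := diffeo_diff_inv Az.
have dc : differentiable (zetai \o zeta) y by exact: differentiable_comp.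
rewrite mulmxBr mulmx1 -jacobian_comp// -deriveEjacobian//.
(* t |-> zetai (zeta (y + t (z - y))) is known only for t in [0, 1], but the
   derivative at 0 exists and can be computed from the right *)
suff -> : 'D_(z - y) (zetai \o zeta) y = z - y by rewrite subrr.
have : derivable (zetai \o zeta) y (z - y) by exact: diff_derivable.
rewrite -[X in X -> _]/(_ --> 'D_(z - y) (zetai \o zeta) y).
have sub : (0 : R)^'+ `=>` 0^'.
  by move=> P HP; apply: (@filterS _ (nbhs (0 : R)) _ _ _ _ HP) => t /= tP t0;
    exact: tP (lt0r_neq0 t0).
move=> /(cvg_trans (cvg_app _ sub)) Dright.
apply/esym/(cvg_unique _ _ Dright) => //.
apply: cvg_trans (near_eq_cvg _) (cvg_cst (z - y)); near=> t.
have t0 : 0 < t by near: t; exact: nbhs_right_gt.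
have t1 : t < 1 by near: t; exact: nbhs_right_lt.
have Bt : B (y + t *: (z - y)) by apply: convex_segment => //; rewrite !ltW.
rewrite /= [t *: _ + y]addrC (zetaK By).2 (zetaK Bt).2 addrAC subrr add0r.
by rewrite scalerA mulVf ?scale1r// gt_eqF.
Unshelve. all: by end_near. Qed.

End Diffeo.

(** * Surfaces with corners *)

Section Surfaces.
Variable R : realType.

(** Removing from a chart domain the other, closed, members of the family leaves
    the chart itself unchanged, since its image avoids them already. *)
Lemma surface_bigcup (k N : nat) (I : choiceType) (P : set I)
    (G : I -> set 'rV[R]_N) :
  finite_set P -> (forall i, P i -> closed (G i)) ->
  (forall i, P i -> surface k (G i)) -> trivIset P G ->
  surface k (\bigcup_(i in P) G i).
Proof.
move=> finP cG sG tG x [i Pi Gix].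
have [Om [W [psi [chi [[oW Wx] C1 im inj [chiK cchi]]]]]] := sG i Pi x Gix.
pose H := \bigcup_(j in P `\ i) G j.
have cH : closed H.
  apply: closed_bigcup; first exact: finite_setD.
  by move=> j [Pj _]; exact: cG.
have GH y : G i y -> ~ H y.
  move=> Gy [j [Pj /= ji] Gjy]; apply: ji.
  by apply: tG => //; exists y.
have WE : (W `&` ~` H) `&` \bigcup_(j in P) G j = W `&` G i.
  apply/seteqP; split=> y /=.
    move=> [[Wy Hy] [j Pj Gjy]]; split=> //.
    have [<-//|ji] := pselect (j = i).
    by exfalso; apply: Hy; exists j.
  by move=> [Wy Gy]; split; [split=> //; exact: GH|exists i].
exists Om, (W `&` ~` H), psi, chi; rewrite WE; split=> //.
split; first by apply: openI => //; exact: closed_openC.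
by split=> //; exact: GH.
Qed.

Definition unit_box (k : nat) : set 'rV[R]_k :=
  [set u | forall i, 0 <= u 0 i <= 1].

Lemma unit_box_compact k : compact (@unit_box k).
Proof.
have := @rV_compact R k (fun=> `[0, 1]%classic) (fun=> @segment_compact _ _ _).
congr compact; apply/seteqP; split=> u /= ub i;
  by have := ub i; rewrite /= in_itv.
Qed.

Lemma open_lt1 k : open [set u : 'rV[R]_k | forall i, u 0 i < 1].
Proof.
rewrite openE => u u1.
suff H (v : 'rV[R]_k) : (forall i, v 0 i < 1) ->
    \forall w \near v, forall i, (w : 'rV[R]_k) 0 i < 1 by exact: H.
move=> v1.
apply: (@filter_forall _ _ (fun i (w : 'rV[R]_k) => w 0 i < 1) (nbhs v)) => i.
exact: (cvgr_lt (v 0 i) (@coord_continuous _ _ _ 0 i v) _ (v1 i)).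
Qed.

(** Replaces v i by 1 - v i for the selected i; this symmetry of the unit box
    turns a face v i = 1 into a face v i = 0, as the orthant model of a corner
    requires.  The matrix form shows that it is affine. *)
Definition flip k (s : 'I_k -> bool) (v : 'rV[R]_k) : 'rV[R]_k :=
  \row_i (s i)%:R + v *m diag_mx (\row_i (-1) ^+ s i).

Lemma flipE k s (v : 'rV[R]_k) i :
  flip s v 0 i = if s i then 1 - v 0 i else v 0 i.
Proof.
rewrite !mxE (bigD1 i)//= big1 => [|j ji]; last first.
  by rewrite !mxE (negPf ji) mulr0n mulr0.
rewrite !mxE eqxx mulr1n addr0; case: (s i) => /=; rewrite ?expr0 ?expr1.
  by rewrite mulrN1.
by rewrite add0r mulr1.
Qed.

Lemma flipK k s : involutive (@flip k s).
Proof.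
by move=> v; apply/rowP => i; rewrite !flipE; case: (s i); rewrite ?subKr.
Qed.

Lemma flip_unit_box k s v : @unit_box k v -> unit_box (flip s v).
Proof.
move=> vb i; rewrite flipE; case: (s i); last exact: vb.
by have /andP[v0 v1] := vb i; rewrite subr_ge0 v1 lerBlDr lerDl.
Qed.

Definition patch (k N : nat) (zeta : 'rV[R]_N -> 'rV[R]_N) (y : 'rV[R]_N)
    (W : 'M[R]_(k, N)) : set 'rV[R]_N :=
  [set zeta (y + u *m W) | u in @unit_box k].

Section Patch.
Variables (k N : nat) (A B : set 'rV[R]_N) (zeta zetai : 'rV[R]_N -> 'rV[R]_N).
Hypothesis dzeta : diffeomorphism B A zeta zetai.
Hypothesis JV : forall y, B y -> 'J zeta y *m 'J zetai (zeta y) = 1%:M.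
Variables (y : 'rV[R]_N) (W : 'M[R]_(k, N)) (D : 'M[R]_(N, k)).
Hypothesis boxB : forall u, unit_box u -> B (y + u *m W).
Hypothesis WD : W *m D \in unitmx.

Lemma patch_compact : compact (patch zeta y W).
Proof.
apply: continuous_compact; last exact: unit_box_compact.
apply/continuous_in_subspaceT => u; rewrite inE => ub.
apply: continuous_comp.
  exact: affine_continuous.
apply: differentiable_continuous; apply: (diffeo_diff dzeta); exact: boxB.
Qed.

(** Around the image of a point of the box the chart is zeta composed with an
    affine parametrization of the box that puts the faces through that point on
    the coordinate hyperplanes.  Its inverse reads the box coordinates of zetai,
    and its differential is injective because 'J zeta and W *m D are
    invertible. *)
Lemma patch_surface : surface k (patch zeta y W).
Proof.
move=> x [u0 u0b <-{x}].
have [_ _ [U [BU C1U]] [V [AV [oV C1V]]]] := dzeta.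
have zB v : B v -> A (zeta v) /\ zetai (zeta v) = v.
  by case: dzeta => + _ _ _; exact.
have oU := C1U.1.
(* only the faces u i = 1 through the given point are flipped; the coordinates
   v i < 1 then describe a neighbourhood of it in the box *)
pose s i := u0 0 i == 1.
pose d : 'rV[R]_k := \row_i (-1) ^+ s i.
pose M := diag_mx d *m W; pose b := y + (\row_i (s i)%:R) *m W.
pose a v := b + v *m M.
have aE v : a v = y + flip s v *m W.
  by rewrite /a /b /M /flip mulmxDl addrA -mulmxA.
pose C1 := [set u : 'rV[R]_k | forall i, u 0 i < 1].
have da v : is_diff v a (mulmxr M) := affine_is_diff b M v.
have ca v : {for v, continuous a} := @affine_continuous _ _ _ b M v.
pose Om := C1 `&` a @^-1` U.
have oOm : open Om.
  apply: openI; first exact: open_lt1.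
  by apply: open_comp => // v _; exact: ca.
have C1a : C1_on Om a by split=> // v _; exact: C1_affine.
pose E := D *m invmx (W *m D).
pose chi x := flip s (- (y *m E) + zetai x *m E).
have WE : W *m E = 1%:M by rewrite mulmxA mulmxV.
have chiE u : unit_box u -> chi (zeta (y + u *m W)) = flip s u.
  by move=> ub; rewrite /chi (zB _ (boxB ub)).2 mulmxDl -mulmxA WE mulmx1 addKr.
have cchi x : V x -> {for x, continuous chi}.
  move=> Vx; have [dzi _] := C1V x Vx.
  have -> : chi = flip s \o ((fun z => - (y *m E) + z *m E) \o zetai) by [].
  apply: continuous_comp; last exact: affine_continuous.
  apply: continuous_comp; last exact: affine_continuous.
  exact: differentiable_continuous.
pose Wo := V `&` chi @^-1` C1.
have oWo : open Wo.
  rewrite openE => x [Vx Cx]; apply: filterI; first exact: open_nbhs_nbhs.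
  by apply: (cchi x Vx); apply: open_nbhs_nbhs; split=> //; exact: open_lt1.
have boxOm v : Om v -> orthant v -> unit_box v.
  by move=> [v1 _] v0 i; rewrite v0 ltW.
have aB v : Om v -> orthant v -> B (a v).
  by move=> /boxOm /[apply] vb; rewrite aE; apply: boxB; exact: flip_unit_box.
have patchV x : patch zeta y W x -> V x.
  by move=> [u ub <-]; apply: AV; case: (zB _ (boxB ub)).
exists Om, Wo, (zeta \o a), chi; split.
- split=> //; split; first by apply: patchV; exists u0.
  rewrite /= chiE// => i; rewrite flipE /s; case: eqP => [->|/eqP u01].
    by rewrite subrr.
  by rewrite lt_neqAle u01; case/andP: (u0b i).
- by apply: (C1_on_comp C1a C1U) => v [].
- apply/seteqP; split=> x.
    move=> [v [Ov v0] <-]; have vb := boxOm _ Ov v0.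
    have pv : patch zeta y W (zeta (a v)).
      by exists (flip s v); [exact: flip_unit_box|rewrite aE].
    split=> //; split; first exact: patchV.
    by rewrite /= aE chiE ?flipK; [case: Ov|exact: flip_unit_box].
  move=> [[Vx Cx] [u ub ux]]; exists (flip s u); last first.
    by rewrite /= aE flipK.
  have au : a (flip s u) = y + u *m W by rewrite aE flipK.
  split; last by move=> i; case/andP: (flip_unit_box s ub i).
  split; last by rewrite /= au; apply: BU; exact: boxB.
  by move: Cx; rewrite /= -ux chiE.
- move=> v Ov v0 w1 w2.
  have Bv := aB v Ov v0; have dz := diffeo_diff dzeta Bv.
  have [dav _] := da v.
  rewrite !diffEjacobian (jacobian_comp dav dz) (jacobian_affine b M).
  have QE : (M *m 'J zeta (a v)) *m ('J zetai (zeta (a v)) *m E) = diag_mx d.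
    by rewrite mulmxA -(mulmxA M) (JV Bv) mulmx1 /M -mulmxA WE mulmx1.
  move=> /(mulmx_eq_trans QE) wd.
  have : flip s w1 = flip s w2 by rewrite /flip wd.
  by move/(inv_inj (@flipK k s)).
- split=> [v Ov v0|].
    by rewrite /= aE chiE ?flipK//; apply: flip_unit_box; exact: boxOm.
  by apply/continuous_in_subspaceT => x; rewrite inE => -[[Vx _] _]; exact: cchi.
Unshelve. all: by end_near. Qed.

End Patch.
End Surfaces.

(** * Rectified flows and transversal boxes *)

Section Transversal.
Variables (R : realType) (n : nat).

(** The projection along the rectified flow. *)
Definition drop_last : 'M[R]_(n.+1, n) := colsub (lift ord_max) 1%:M.

Lemma mul_drop_last m (w : 'M[R]_(m, n.+1)) :
  w *m drop_last = colsub (lift ord_max) w.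
Proof. by rewrite mulmx_colsub mulmx1. Qed.

Lemma drop_last_free k (c : 'M[R]_(n, k)) : drop_last *m c = 0 -> c = 0.
Proof.
move=> Dc; apply/matrixP => j l.
have := congr1 (fun A : 'M[R]_(n.+1, k) => A (lift ord_max j) l) Dc.
rewrite !mxE => <-.
rewrite (bigD1 j)//= big1 => [|i ij]; last first.
  by rewrite !mxE (inj_eq lift_inj) eq_sym (negPf ij) mul0r.
by rewrite !mxE eqxx mul1r addr0.
Qed.

Lemma drop_last_eq0 (w : 'rV[R]_n.+1) :
  w *m drop_last = 0 -> w = w 0 ord_max *: e_last R n.
Proof.
rewrite mul_drop_last => w0; apply/rowP => i; rewrite !mxE eqxx/=.
have [j ->|->] := unliftP ord_max i; last by rewrite eqxx mulr1.
have := congr1 (fun A : 'rV[R]_n => A 0 j) w0; rewrite !mxE => ->.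
by rewrite eq_sym (negPf (neq_lift _ _)) mulr0.
Qed.

Lemma e_last_drop : e_last R n *m drop_last = 0.
Proof.
rewrite mul_drop_last; apply/rowP => j.
by rewrite !mxE eqxx/= eq_sym (negPf (neq_lift _ _)).
Qed.

(** The box has a corner at y, and its edges point towards points of B; this is
    what keeps it inside B when y is a boundary point.  Invertibility of
    W *m drop_last says that the box is transversal to e_last. *)
Lemma transversal_box (B : set 'rV[R]_n.+1) y (e : R) :
  convex_set B -> B y -> 0 < e ->
  (forall c : 'cV[R]_n.+1, (forall z, B z -> (z - y) *m c = 0) -> c = 0) ->
  exists W : 'M[R]_(n, n.+1), [/\ W *m drop_last \in unitmx,
    forall u, unit_box u -> B (y + u *m W) &
    forall u, unit_box u -> `|u *m (W *m drop_last)| < e].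
Proof.
move=> cB By e0 spanB.
have [|W WB Wu] := @unitmx_of_spanning_rows _ _ _ [set w | B (y + w)] drop_last.
  move=> c Hc; apply: drop_last_free; apply: spanB => z Bz.
  by rewrite mulmxA; apply: Hc; rewrite /= addrC subrK.
pose C := \sum_i `|row i (W *m drop_last)|.
have C0 : 0 <= C by apply: sumr_ge0.
have C1 : 0 < C + 1 by rewrite ltr_wpDl.
(* multiples by d of the n edges keep the sum of the weights below n / n.+1 < 1
   and the size of the projection below e *)
pose d := Num.min (n.+1%:R^-1) (e / (C + 1)).
have d0 : 0 < d by rewrite lt_min invr_gt0 ltr0Sn divr_gt0.
have normle u : unit_box u -> `|u *m (W *m drop_last)| <= C.
  move=> ub; rewrite mulmx_sum_row (le_trans (ler_norm_sum _ _ _))//.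
  rewrite ler_sum// => i _.
  have /andP[ui0 ui1] := ub i.
  by rewrite normrZ ler_piMl// ger0_norm.
exists (d *: W); split=> [|u ub|u ub].
- by rewrite -scalemxAl unitmxZ// unitfE gt_eqF.
- rewrite -scalemxAr scalemxAl; apply: convex_corner => // [i|].
    by rewrite mxE mulr_ge0 ?(ltW d0)//; case/andP: (ub i).
  apply: (@le_lt_trans _ _ (\sum_(i < n) n.+1%:R^-1)).
    apply: ler_sum => i _; rewrite mxE; have /andP[ui0 ui1] := ub i.
    by rewrite (@le_trans _ _ d) ?ge_min ?lexx// ler_piMr ?(ltW d0).
  rewrite sumr_const card_ord -[X in X < _]mulr_natl ltr_pdivrMr ?ltr0Sn//.
  by rewrite mul1r ltr_nat.
- rewrite -scalemxAl -scalemxAr normrZ (gtr0_norm d0).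
  apply: (@le_lt_trans _ _ (e / (C + 1) * C)).
    by rewrite ler_pM ?(ltW d0) ?normr_ge0 ?normle// ge_min lexx orbT.
  by rewrite mulrAC ltr_pdivrMr// ltr_pM2l// ltrDl.
Qed.

Section Flow.
Variables (X : set 'rV[R]_n.+1) (f : 'rV[R]_n.+1 -> 'rV[R]_n.+1)
  (S : R -> 'rV[R]_n.+1 -> 'rV[R]_n.+1) (A B : set 'rV[R]_n.+1)
  (zeta zetai : 'rV[R]_n.+1 -> 'rV[R]_n.+1).
Hypothesis lipf : [lipschitz f x | x in X].
Hypothesis flowS : is_flow X f S.
Hypothesis AX : A `<=` X.
Hypothesis dzeta : diffeomorphism B A zeta zetai.
Hypothesis JV : forall y, B y -> 'J zeta y *m 'J zetai (zeta y) = 1%:M.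
Hypothesis rect : forall y, B y -> e_last R n = f (zeta y) *m invmx ('J zeta y).

Lemma rectE y : B y -> f (zeta y) = e_last R n *m 'J zeta y.
Proof. by move=> By; exact: (mulmx_invmxP (JV By) (rect By)).1. Qed.

Lemma rectVE x : A x -> e_last R n = f x *m 'J zetai x.
Proof.
have [_ zi _ _] := dzeta; move=> /zi[Bx zx].
by have := (mulmx_invmxP (JV Bx) (rect Bx)).2; rewrite zx.
Qed.

(** By [rectVE], zetai carries the orbit to a solution of the constant field
    e_last, and so does the straight line. *)
Lemma flow_rectified x t : 0 < t -> (forall s, 0 <= s <= t -> A (S s x)) ->
  X x -> zetai (S t x) = zetai x + t *: e_last R n.
Proof.
move=> t0 AS Xx.
have S0 : S 0 x = x by case: (flowS Xx).
apply: (@ode_unique _ _ setT (fun=> e_last R n) t (zetai \o (S ^~ x))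
    (fun s => zetai x + s *: e_last R n)) => //.
- exists 0; split=> // M M0 [a b] _ /=.
  by rewrite subrr normr0 mulr_ge0 ?(ltW M0).
- apply: (solves_comp (flow_solves flowS Xx t0)) => s.
    by move=> /AS; exact: (diffeo_diff_inv dzeta).
  by move=> /andP[s0 st]; apply: rectVE; apply: AS; rewrite !ltW.
- exact: line_solves.
- by rewrite /= S0 scale0r addr0.
Qed.

(** By convexity the segment from zetai x to zetai x' lies in B, and by [rectE]
    its image under zeta is a solution of f in X starting at x. *)
Lemma flow_along_segment x x' t : convex_set B -> 0 < t -> A x -> A x' ->
  zetai x' = zetai x + t *: e_last R n -> S t x = x'.
Proof.
move=> cB t0 Ax Ax' xx'; have Xx := AX Ax.
have [zB zA _ _] := dzeta.
have [Bx zx] := zA x Ax; have [Bx' zx'] := zA x' Ax'.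
have S0 : S 0 x = x by case: (flowS Xx).
have Bl s : 0 <= s <= t -> B (zetai x + s *: e_last R n).
  move=> /andP[s0 st].
  have := convex_segment cB Bx Bx' (t := s / t).
  rewrite xx' [_ + _ - _]addrAC subrr add0r scalerA divfK ?gt_eqF//; apply.
  by rewrite divr_ge0 ?(ltW t0)//= ler_pdivrMr// mul1r.
rewrite -zx' xx'.
apply: (@ode_unique _ _ X f t (S ^~ x)
    (zeta \o (fun s => zetai x + s *: e_last R n))) => //.
- exact: (flow_solves flowS Xx t0).
- apply: (solves_comp (line_solves _ _ _)) => s st.
    exact/(diffeo_diff dzeta)/Bl.
  by apply/rectE/Bl; case/andP: st => s0 st; rewrite !ltW.
- move=> s st; split; last by apply: AX; case: (zB _ (Bl s st)).
  by case/andP: st => s0 _; case: (flowS Xx) => _ /(_ s s0)[].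
- by rewrite /= S0 scale0r addr0 zx.
Qed.

Lemma same_trajectory_of_drop_last p q : convex_set B -> A p -> A q ->
  zetai p *m drop_last = zetai q *m drop_last ->
  p = q \/ same_trajectory X S p q \/ same_trajectory X S q p.
Proof.
move=> cB Ap Aq pq; have [_ zA _ _] := dzeta.
have [_ zp] := zA p Ap; have [_ zq] := zA q Aq.
have : (zetai q - zetai p) *m drop_last = 0 by rewrite mulmxBl pq subrr.
move=> /drop_last_eq0; set t := _ 0 ord_max => qp.
have traj a b s : A a -> A b -> 0 < s -> zetai b = zetai a + s *: e_last R n ->
    same_trajectory X S a b.
  move=> Aa Ab s0 ab; exists a; split; first exact: AX.
  exists 0, s; split=> //; first exact: ltW.
    by case: (flowS (AX Aa)).
  exact: flow_along_segment.
have [t0|t0|t0] := ltgtP t 0.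
- right; right; apply: (@traj _ _ (- t)) => //; first by rewrite oppr_gt0.
  by rewrite scaleNr -qp opprB addrC subrK.
- by right; left; apply: (@traj _ _ t) => //; rewrite -qp addrC subrK.
- left; rewrite -zp -zq; congr zeta; apply/esym/eqP.
  by rewrite -subr_eq0 qp t0 scale0r.
Qed.

End Flow.
End Transversal.

(** * The surface *)

Theorem lemma1 (R : realType) (n : nat) (X : set 'rV[R]_n.+1)
    (f : 'rV[R]_n.+1 -> 'rV[R]_n.+1) (S : R -> 'rV[R]_n.+1 -> 'rV[R]_n.+1)
    (hf : [lipschitz f x | x in X]) (hS : is_flow X f S)
    (Gamma X' : set 'rV[R]_n.+1)
    (hGfin : finite_set Gamma) (hGX' : Gamma `<=` X') (hX'X : X' `<=` X)
    (hX'c : compact X') (hX'full : interior X' !=set0)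
    (hrect : rectifiable_on X' f S)
    (hG : forall p q, Gamma p -> Gamma q -> p <> q ->
            ~ same_trajectory X S p q) :
  exists Ghat : set 'rV[R]_n.+1,
    [/\ surface n Ghat,
        Gamma `<=` Ghat /\ Ghat `<=` X,
        closed Ghat
      & forall x, Ghat x -> forall t, 0 < t ->
          (forall t', 0 <= t' <= t -> X' (S t' x)) -> ~ Ghat (S t x)].
Proof.
have [B [zeta [zetai [_ [cB dzeta _ [_ rect]]]]]] := hrect.
have [zB zA _ _] := dzeta.
have JV := diffeo_jacobianV dzeta cB hX'full.
pose D := drop_last R n.
have [e e0 sep] : exists2 e : R, 0 < e & forall p q, Gamma p -> Gamma q ->
    p <> q -> e <= `|zetai p *m D - zetai q *m D|.
  apply: finite_separated hGfin _ => p q Gp Gq pq pqD.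
  have := same_trajectory_of_drop_last hf hS hX'X dzeta JV rect cB
    (hGX' _ Gp) (hGX' _ Gq) pqD.
  by case=> [//|[]]; apply: hG => //; exact: nesym.
have /choice[W WP] : forall p, exists Wp : 'M[R]_(n, n.+1), Gamma p ->
    [/\ Wp *m D \in unitmx,
        forall u, unit_box u -> B (zetai p + u *m Wp) &
        forall u, unit_box u -> `|u *m (Wp *m D)| < e / 2].
  move=> p; have [Gp|nGp] := pselect (Gamma p); last by exists 0.
  have [Bp _] := zA p (hGX' _ Gp).
  have e20 : 0 < e / 2 by rewrite divr_gt0.
  have [|Wp WpP] := transversal_box cB Bp e20; last by exists Wp.
  by move=> c; exact: (diffeo_not_in_hyperplane dzeta hX'full).
pose G p := patch zeta (zetai p) (W p).
have GX' p : Gamma p -> G p `<=` X'.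
  by move=> /WP[_ pB _] x [u /pB/zB[] ? _ <-].
(* the projections of two boxes are less than e / 2 away from points at distance
   at least e, and within one box the projection is injective *)
have projI p q u v : Gamma p -> Gamma q -> unit_box u -> unit_box v ->
    (zetai p + u *m W p) *m D = (zetai q + v *m W q) *m D -> p = q /\ u = v.
  move=> Gp Gq ub vb uv.
  have [Wpu _ pe] := WP p Gp; have [_ _ qe] := WP q Gq.
  have pq : p = q.
    apply: contrapT => /(sep p q Gp Gq); apply/negP; rewrite -ltNge.
    have -> : zetai p *m D - zetai q *m D = v *m (W q *m D) - u *m (W p *m D).
      apply/eqP; rewrite subr_eq addrAC eq_sym subr_eq; apply/eqP.
      by move: uv; rewrite !mulmxDl -!mulmxA addrC => <-; rewrite addrC.
    rewrite (le_lt_trans (ler_normB _ _))// [ltRHS]splitr.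
    by rewrite ltrD ?pe ?qe.
  split=> //; move: uv; rewrite -pq !mulmxDl => /addrI.
  by rewrite -!mulmxA => /(can_inj (mulmxK Wpu)).
have inG p x : Gamma p -> G p x ->
    exists2 u, unit_box u & zetai x = zetai p + u *m W p.
  by move=> Gp [u ub <-]; exists u => //; have [_ /(_ u ub)/zB[]] := WP p Gp.
have cG p : Gamma p -> closed (G p).
  move=> /WP[_ pB _]; apply: compact_closed; first exact: norm_hausdorff.
  exact: (patch_compact dzeta pB).
exists (\bigcup_(p in Gamma) G p); split.
- apply: surface_bigcup => // [p /WP[Wu pB _]|p q Gp Gq [x [Gpx Gqx]]].
    exact: (patch_surface dzeta JV pB Wu).
  have [u ub xu] := inG p x Gp Gpx; have [v vb xv] := inG q x Gq Gqx.
  by have [] := projI p q u v Gp Gq ub vb; rewrite -?xu -?xv.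
- split; last by move=> x [p Gp /(GX' _ Gp)]; exact: hX'X.
  move=> p Gp; exists p => //; exists 0.
    by move=> i; rewrite mxE lexx ler01.
  by rewrite mul0mx addr0; case: (zA p (hGX' _ Gp)).
- exact: closed_bigcup.
- move=> x [p Gp Gpx] t t0 orb [q Gq Gqx].
  have Xx : X x by exact/hX'X/(GX' _ Gp).
  have [u ub xu] := inG p x Gp Gpx; have [v vb xv] := inG q _ Gq Gqx.
  have xt := flow_rectified hS dzeta JV rect t0 orb Xx.
  have [pq uv] : p = q /\ u = v.
    apply: projI => //; rewrite -xu -xv xt mulmxDl -scalemxAl.
    by rewrite /D e_last_drop scaler0 addr0.
  move: xt; rewrite xu xv -pq -uv -[LHS]addr0 => /addrI/esym/eqP.
  rewrite scaler_eq0 gt_eqF//= => /eqP/rowP/(_ ord_max).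
  by rewrite !mxE !eqxx => /eqP; rewrite oner_eq0.
Qed.
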